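(* Let $T(x)=1+\sum_{n\ge1}t_nx^n$ be the cluster generating function for the consecutive pattern $15243$ (defined in the context). Then $T$ satisfies \[x^3T'(x) = 1 + x - T\!\left(\frac{x}{1+x^2}\right),\] with $T(0)=1$.
   Context: For a consecutive pattern $\sigma$ of length $m$ (here $\sigma=15243$, $m=5$): an occurrence of $\sigma$ in a permutation is a block of $m$ consecutive positions whose entries are in the same relative order as $\sigma$. A $k$-cluster of length $n\ge m$ is a permutation of $\{1,\dots,n\}$ containing precisely $k$ occurrences of $\sigma$, such that every entry belongs to at least one occurrence and any two successive occurrences overlap in at least one position. Let $s_{n,k}$ be the number of $k$-clusters of length $n$, with $s_{1,0}=1$ and $s_{n,k}=0$ otherwise for $n<m$; set $t_n=\sum_k(-1)^ks_{n,k}$ and $T(x)=1+\sum_{n\ge1}t_nx^n$.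
   Formalization: A k-cluster is taken as a permutation with a chosen set of k marked occurrences that cover all entries and overlap successively; with ''precisely k occurrences'' in total, as written, t_9 would be 13, while the equation requires 14. *)

(* Defs.v *)
From mathcomp Require Import all_boot all_order all_algebra all_fingroup.
Set Implicit Arguments. Unset Strict Implicit. Unset Printing Implicit Defensive.
Import Order.TTheory GRing.Theory Num.Theory.

Definition m : nat := 5.
Definition sigma : seq nat := [:: 1; 5; 2; 4; 3].

(* the entry of pi at position j (0 if j is out of range; never used so) *)
Definition entry (n : nat) (pi : {perm 'I_n}) (j : nat) : nat :=
  if insub j is Some o then nat_of_ord (pi o) else 0%N.

Definition occurrence (n : nat) (pi : {perm 'I_n}) (i : nat) : bool :=
  (i + m <= n) &&
  [forall a : 'I_m, forall b : 'I_m,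
     (entry pi (i + a) < entry pi (i + b))%N
       == (nth 0 sigma a < nth 0 sigma b)%N].

(* A cluster structure on pi with marked occurrence set S (positions of the
   first entries of the marked occurrences): every marked position is an
   occurrence, every entry lies in some marked occurrence, and any two
   successive marked occurrences overlap in at least one position. *)
Definition is_cluster (n : nat) (pi : {perm 'I_n}) (S : {set 'I_n}) : bool :=
  [forall p in S, occurrence pi p] &&
  [forall j : 'I_n, exists p in S, (p <= j < p + m)%N] &&
  [forall p in S, forall q in S,
     ((p < q)%N && [forall r in S, ~~ (p < r < q)%N]) ==> (q < p + m)%N].

Definition s_nk (n k : nat) : nat :=
  if (n < m)%N then ((n == 1%N) && (k == 0%N) : nat)
  else #|[set x : {perm 'I_n} * {set 'I_n} | is_cluster x.1 x.2 && (#|x.2| == k)]|.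

(* t_n = sum_k (-1)^k s_{n,k}; a k-cluster of length n has k <= n. *)
Definition t_n (n : nat) : int :=
  (\sum_(k < n.+1) (-1) ^+ k * (s_nk n k)%:Z)%R.

Definition fps := nat -> int.

Definition fconst (c : int) : fps := fun n => if n == 0%N then c else 0%R.
Definition fXn (k : nat) : fps := fun n => if n == k then 1%R else 0%R.
Definition fadd (f g : fps) : fps := fun n => (f n + g n)%R.
Definition fsub (f g : fps) : fps := fun n => (f n - g n)%R.
Definition fmul (f g : fps) : fps :=
  fun n => (\sum_(i < n.+1) f i * g (n - i)%N)%R.
Fixpoint fpow (g : fps) (k : nat) : fps :=
  if k is k'.+1 then fmul g (fpow g k') else fconst 1.
Definition fderiv (f : fps) : fps := fun n => (n.+1%:Z * f n.+1)%R.
(* composition f(g(x)), meaningful when g has zero constant term: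
   [x^n] f(g) = sum_{k <= n} f_k [x^n] g^k *)
Definition fcomp (f g : fps) : fps :=
  fun n => (\sum_(k < n.+1) f k * fpow g k n)%R.

Definition Tser : fps := fun n => if n == 0%N then 1%R else t_n n.

(* Main.v *)
(* Two occurrences of 15243 can only overlap with shift 2 or 4.  Hence in a
   cluster with marked occurrences the entries c_0 < c_1 < ... < c_M at even
   positions increase, the unmarked even positions cut the marks into maximal
   runs, and a run of j - 1 marks puts a decreasing block of j entries at odd
   positions, all lying above c_j and otherwise unrelated to what follows.
   Cutting a cluster after its first run, the j odd entries of that run are
   shuffled freely with the n - 2j - 1 later entries above c_j, whence
     t_n = sum_(j >= 2) (-1)^(j-1) C(n-j-1, j) t_(n-2j)   for n >= 2.
   As [x^n] (x/(1+x^2))^(n-2j) = (-1)^j C(n-j-1, j), this is the coefficient of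
   x^n in the functional equation: j = 0 contributes t_n, and j = 1 contributes
   -(n-2) t_(n-2), the coefficient of x^3 T'. *)

Require Import Defs.
From mathcomp Require Import all_boot all_order all_algebra all_fingroup.
From mathcomp Require Import zify ring.
Import Order.TTheory GRing.Theory Num.Theory.

(** * Counting linear extensions *)

(* The number of orderings of [s] in which no [x] precedes a [y] with [R y x],
   obtained by choosing the first element. *)
Fixpoint linext_rec (T : eqType) (R : rel T) (k : nat) (s : seq T) : nat :=
  if k is k'.+1 then
    \sum_(x <- s | all (fun y => ~~ R y x) s) linext_rec T R k' (rem x s)
  else 1.

Definition linext {T : eqType} (R : rel T) (s : seq T) : nat :=
  linext_rec T R (size s) s.

Section LinearExtensions.
Variables (T : eqType).
Implicit Types (R : rel T) (s : seq T).

Lemma linext_rem R s : s != [::] ->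
  linext R s = \sum_(x <- s | all (fun y => ~~ R y x) s) linext R (rem x s).
Proof.
case: s => [//|z s] _; rewrite /linext [size _]/= [LHS]/=.
rewrite big_seq_cond [RHS]big_seq_cond; apply: eq_bigr => x /andP[xs _].
by rewrite size_rem.
Qed.

Lemma eq_in_linext R R' s : {in s &, R =2 R'} -> linext R s = linext R' s.
Proof.
move: {2}(size s) (leqnn (size s)) => k; elim: k s => [|k IHk] s.
  by rewrite leqn0 => /nilP ->.
case: s => [//|z s]; set t := z :: s => szt eqR.
rewrite !linext_rem // big_seq_cond [RHS]big_seq_cond.
apply: eq_big => [x|x /andP[xt _]].
  case xt: (x \in t); rewrite ?andTb ?andFb //.
  by apply: eq_in_all => y yt; rewrite eqR.
apply: IHk; first by rewrite size_rem //= -ltnS.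
by move=> a b /mem_rem ha /mem_rem hb; apply: eqR.
Qed.

(** Neither [x] nor [y] can be chosen first while the other remains, so both survive every removal
    and the admissible choices run out. *)
Lemma linext_conflict R s (x y : T) :
  x \in s -> y \in s -> R x y -> R y x -> linext R s = 0.
Proof.
move: {2}(size s) (leqnn (size s)) => k; elim: k s => [|k IHk] s.
  by rewrite leqn0 => /nilP ->.
move=> szs xs ys Rxy Ryx.
rewrite linext_rem; last by case: (s) xs.
rewrite big_seq_cond big1 // => z /andP[zs /allP minz].
have zx : x != z by apply: contraTneq Ryx => ->; apply: minz.
have zy : y != z by apply: contraTneq Rxy => ->; apply: minz.
have in_rem (a : T) : a \in s -> a != z -> a \in rem z s.
  move=> a_s az; have := perm_to_rem zs; move/perm_mem/(_ a).
  by rewrite a_s in_cons (negbTE az) /= => <-.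
apply: IHk => //; try exact: in_rem.
by rewrite size_rem // -ltnS prednK // lt0n size_eq0; case: (s) xs.
Qed.

(* [R] need not be transitive: it suffices that every other element has some
   predecessor in [s]. *)
Lemma linext_unique_min R s (x : T) : uniq s -> x \in s ->
    {in s, forall y, ~~ R y x} ->
    {in s, forall y, y != x -> has (R^~ y) s} ->
  linext R s = linext R [seq y <- s | y != x].
Proof.
move=> Us xs minx nminy.
rewrite linext_rem; last by case: (s) xs.
rewrite (big_rem x) //= ifT; last exact/allP.
rewrite big_seq_cond big1 ?addn0 ?rem_filter //.
move=> y /andP[]; rewrite mem_filter => /andP[/= yx ys] /allP min_y.
by have /hasP[z zs Rzy] := nminy y ys yx; rewrite (negbTE (min_y z zs)) in Rzy.
Qed.

(** The factor handles the empty sequence, where the sum is empty although [linext] is 1. *)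
Lemma linext_sum_rem R s :
  \sum_(x <- s | all (fun y => ~~ R y x) s) linext R (rem x s) =
  (s != [::]) * linext R s.
Proof. by case: eqVneq => [->|/linext_rem ->]; rewrite ?big_nil ?mul1n. Qed.

(* Shuffles: removing a minimal element from either part is Pascal's rule. *)
Lemma linext_shuffle R s (A : pred T) : uniq s ->
    {in s &, forall x y, R x y -> A x = A y} ->
  linext R s = 'C(size s, count A s) *
    (linext R [seq x <- s | A x] * linext R [seq x <- s | ~~ A x]).
Proof.
move: {2}(size s) (erefl (size s)) => k; elim: k s A => [|k IHk] s A.
  by move/size0nil => ->.
move=> szs Us sepR.
rewrite linext_rem; last by rewrite -size_eq0 szs.
have minE (B : pred T) x : x \in s -> B x ->
    {in s, forall y, R y x -> B y} ->
    all (fun y => ~~ R y x) s = all (fun y => ~~ R y x) [seq y <- s | B y].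
  move=> xs Bx clB; rewrite all_filter; apply: eq_in_all => y ys /=.
  by case Ryx: (R y x) => /=; rewrite ?implybT // (clB y).
(* Orderings whose first element lies in [B]; applied below to [A] and to its complement. *)
have step (B : pred T) : {in s &, forall x y, R x y -> B x = B y} ->
    \sum_(x <- s | all (fun y => ~~ R y x) s && B x) linext R (rem x s) =
    'C(k, (count B s).-1) * ([seq x <- s | B x] != [::]) *
    (linext R [seq x <- s | B x] * linext R [seq x <- s | ~~ B x]).
  move=> sepB; rewrite -mulnA (mulnA (_ != _ : nat)) -linext_sum_rem.
  rewrite big_filter_cond mulnC big_distrl /= big_distrl /=.
  rewrite big_seq_cond [RHS]big_seq_cond.
  apply: eq_big => [x|x /and3P[xs minx Bx]].
    case xs: (x \in s) => //=; case Bx: (B x); rewrite ?andbF // andbT.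
    by apply: minE => // y ys /sepB ->.
  have Urem := rem_uniq x Us.
  rewrite (IHk _ B) //; last 2 first.
  - by rewrite size_rem // szs.
  - by move=> a b /mem_rem as_ /mem_rem bs; apply: sepB.
  rewrite size_rem // szs /= count_rem xs /= Bx subn1 mulnC; congr (_ * _ * _).
    rewrite !rem_filter ?filter_uniq // -!filter_predI.
    by congr linext; apply: eq_filter => y /=; rewrite andbC.
  rewrite rem_filter // -filter_predI; congr linext; apply: eq_filter => y /=.
  by case: eqP => [->|]; rewrite ?Bx ?andbT.
rewrite (bigID A) /= step // (step (predC A)) /=; last first.
  by move=> x y xs ys Rxy; rewrite (sepR x y).
have -> : [seq x <- s | ~~ ~~ A x] = [seq x <- s | A x].
  by apply: eq_filter => x; rewrite negbK.
rewrite (mulnC (linext R [seq x <- s | ~~ A x])) -mulnDl; congr (_ * _).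
rewrite -!has_filter !has_count.
have := count_predC A s; rewrite szs.
case: (count A s) => [|a]; case: (count (predC A) s) => [|b] //=.
- by rewrite add0n => -[->]; rewrite !muln0 muln1 bin0 binn.
- by rewrite addn0 => -[->]; rewrite !muln0 addn0 muln1 !binn.
- rewrite addSn => -[<-]; rewrite !muln1 binS addnC; congr (_ + _).
  by rewrite -addSnnS -[in LHS](bin_sub (leq_addl a.+1 b)) addnK.
Qed.

(** Grouping permutations by first letter gives the recursion of [linext]. Irreflexivity reconciles
    the tests: [linext] also compares the chosen element with itself, [pairwise] does not. *)
Lemma linext_permutations R s : irreflexive R -> uniq s ->
  linext R s = count (pairwise (fun x y => ~~ R y x)) (permutations s).
Proof.
move=> irR; move: {2}(size s) (erefl (size s)) => k.
elim: k s => [|k IHk] s szs Us.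
  by rewrite (size0nil szs).
rewrite linext_rem; last by rewrite -size_eq0 szs.
have s_gt0 : 0 < size s by rewrite szs.
rewrite (seq.permP (permutationsE s_gt0)).
rewrite undup_id // count_flatten -map_comp sumnE big_map big_mkcond.
rewrite big_seq [RHS]big_seq; apply: eq_bigr => x xs /=.
rewrite count_map; have Urem := rem_uniq x Us.
case: ifPn => [minx|nminx].
  rewrite IHk ?size_rem ?szs //; apply: eq_in_count => t.
  rewrite mem_permutations => /perm_mem t_eq /=.
  rewrite [all _ _](_ : _ = true) //; apply/allP => y.
  by rewrite t_eq => /mem_rem /(allP minx).
symmetry; apply/eqP; rewrite -leqn0 leqNgt -has_count -all_predC.
apply/allP => t; rewrite mem_permutations => /perm_mem t_eq /=.
apply: contra nminx => /andP[/allP min_t _]; apply/allP => y ys.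
have [->|yx] := eqVneq y x; first by rewrite irR.
by apply: min_t; rewrite t_eq mem_rem_uniq // inE yx.
Qed.

End LinearExtensions.

Lemma linext_map (T U : eqType) (h : T -> U) (R : rel U) (s : seq T) :
  injective h -> linext R (map h s) = linext (relpre h R) s.
Proof.
move=> injh; move: {2}(size s) (erefl (size s)) => k.
elim: k s => [|k IHk] s szs; first by rewrite (size0nil szs).
rewrite !linext_rem -?size_eq0 ?size_map ?szs // big_map.
rewrite big_seq_cond [RHS]big_seq_cond; apply: eq_big => [x|x /andP[xs _]].
  by rewrite all_map.
have map_rem : rem (h x) (map h s) = map h (rem x s).
  by elim: (s) => //= y t ->; rewrite (inj_eq injh); case: ifP.
by rewrite map_rem IHk // size_rem // szs.
Qed.

(** * Permutations and sets of marks as words *)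

Section PermutationWords.
Variable n : nat.
Implicit Type pi : {perm 'I_n}.

(** The positions listed by increasing entry: [pi x < pi y] means that [x] stands before [y] in this
    word. *)
Definition perm_word pi : seq nat := [seq val (pi^-1%g i) | i <- enum 'I_n].

Lemma perm_word_inj : injective perm_word.
Proof.
move=> pi rho eq_w; apply: invg_inj; apply/permP => i; apply: val_inj.
by move/eq_in_map: eq_w => /(_ i); apply; rewrite mem_enum.
Qed.

Lemma perm_words_permutations :
  perm_eq [seq perm_word pi | pi <- enum {: {perm 'I_n}}]
          (permutations (iota 0 n)).
Proof.
have Uw : uniq [seq perm_word pi | pi <- enum {: {perm 'I_n}}].
  by rewrite map_inj_uniq ?enum_uniq //; exact: perm_word_inj.
apply: uniq_perm => //; first exact: permutations_uniq.
apply: (uniq_min_size Uw _ _).2.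
  move=> w /mapP[pi _ ->]; rewrite mem_permutations.
  have Uwpi : uniq (perm_word pi).
    rewrite map_inj_uniq ?enum_uniq // => i j /val_inj; exact: perm_inj.
  apply: uniq_perm => //; first exact: iota_uniq.
  apply: (uniq_min_size Uwpi _ _).2.
    by move=> x /mapP[i _ ->]; rewrite mem_iota /=.
  by rewrite size_map size_iota size_enum_ord.
by rewrite size_permutations ?iota_uniq // size_iota size_map -cardE card_Sn.
Qed.

Lemma card_perm_linext (R : rel nat) : irreflexive R ->
  #|[set pi : {perm 'I_n} |
       [forall x : 'I_n, forall y : 'I_n, R x y ==> (pi x < pi y)%N]]| =
  linext R (iota 0 n).
Proof.
move=> irR; rewrite linext_permutations ?iota_uniq //.
rewrite -(seq.permP perm_words_permutations) count_map.
rewrite enumT cardE size_filter; apply: eq_count => pi /=; rewrite inE.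
rewrite pairwise_map; apply/idP/idP => [/forallP mono|].
  have: pairwise (relpre val ltn) (enum 'I_n).
    rewrite -pairwise_map val_enum_ord -sorted_pairwise ?iota_ltn_sorted //.
    exact: ltn_trans.
  apply: sub_pairwise => i j /= lt_ij.
  have /forallP/(_ (pi^-1 i)%g) := mono (pi^-1%g j); rewrite !permKV.
  by apply: contraTN => Rji; rewrite Rji /= ltnNge ltnW.
case: n pi => [|n'] pi; first by move=> _; apply/forallP => -[].
move/(pairwiseP ord0) => pw; apply/forallP => x; apply/forallP => y.
apply/implyP => Rxy; rewrite ltnNge leq_eqVlt; apply/negP => /orP[/eqP|lt_yx].
  by move/val_inj/perm_inj => eq_yx; rewrite eq_yx irR in Rxy.
have := pw (pi y) (pi x).
rewrite !inE size_enum_ord !ltn_ord => /(_ isT isT lt_yx).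
by rewrite /= !nth_ord_enum !permK Rxy.
Qed.
End PermutationWords.

Fixpoint masks (n : nat) : seq bitseq :=
  if n is n'.+1 then map (cons true) (masks n') ++ map (cons false) (masks n')
  else [:: [::]].

Lemma mem_masks n (b : bitseq) : (b \in masks n) = (size b == n).
Proof.
elim: n b => [|n IHn] [|c b] //=; rewrite mem_cat.
  by apply/negP => /orP[] /mapP[].
rewrite eqSS -IHn.
case: c; rewrite mem_map //; try by move=> ? ? [].
  by case: (b \in _) => //=; apply/negP => /mapP[].
by case: (b \in _) => //=; rewrite ?orbT ?orbF //; apply/negP => /mapP[].
Qed.

Lemma size_masks n : size (masks n) = 2 ^ n.
Proof.
by elim: n => //= n IHn; rewrite size_cat !size_map IHn expnS mul2n addnn.
Qed.

Definition set_mask n (A : {set 'I_n}) : bitseq := [seq i \in A | i <- enum 'I_n].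

Lemma size_set_mask n (A : {set 'I_n}) : size (set_mask n A) = n.
Proof. by rewrite size_map size_enum_ord. Qed.

Lemma nth_set_mask n (A : {set 'I_n}) (i : 'I_n) :
  nth false (set_mask n A) i = (i \in A).
Proof. by rewrite (nth_map i) ?size_enum_ord // nth_ord_enum. Qed.

Lemma count_set_mask n (A : {set 'I_n}) : count id (set_mask n A) = #|A|.
Proof. by rewrite count_map cardE enumT size_filter. Qed.

Lemma set_masks_perm n :
  perm_eq [seq set_mask n A | A <- enum {: {set 'I_n}}] (masks n).
Proof.
have Um : uniq (masks n).
  elim: n => //= n IHn; rewrite cat_uniq !map_inj_uniq ?IHn //=;
    try by move=> ? ? [].
  by rewrite andbT; apply/hasPn => _ /mapP[b _ ->]; apply/negP => /mapP[].
have injm : injective (set_mask n).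
  by move=> A B eqm; apply/setP => i; rewrite -!nth_set_mask eqm.
have Us : uniq [seq set_mask n A | A <- enum {: {set 'I_n}}].
  by rewrite map_inj_uniq ?enum_uniq.
apply: uniq_perm => //; apply: (uniq_min_size Us _ _).2.
  by move=> _ /mapP[A _ ->]; rewrite mem_masks size_set_mask.
by rewrite size_masks size_map -cardE -cardsT -powersetT card_powerset cardsT card_ord.
Qed.

(** * Marked clusters *)

(** The inequalities between entries forced by single marked occurrences, without transitive
    closure. *)
Definition mark_rel (b : bitseq) : rel nat := fun x y =>
  has (fun p => [&& nth false b p, p <= x < p + 5, p <= y < p + 5
                  & nth 0 sigma (x - p) < nth 0 sigma (y - p)]%N)
      (iota 0 (size b)).

(* Every mark but the last one is followed by a mark less than 5 further.
   Length 1 is special: there the cluster has one entry and no mark. *)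
Definition linked (b : bitseq) : bool :=
  if size b == 1 then ~~ has id b else
  nth false b 0 &&
  all (fun p => nth false b p ==>
         (p + 5 == size b) ||
         ((p + 5 < size b) &&
            has (fun q => nth false b q && (p < q < p + 5)) (iota 0 (size b))))
      (iota 0 (size b)).

Lemma nth_mark_lt (b : bitseq) p : nth false b p -> p < size b.
Proof. by rewrite ltnNge; apply: contraTN => le_bp; rewrite nth_default. Qed.

Lemma mark_relP (b : bitseq) x y :
  reflect (exists p, [/\ nth false b p, p <= x < p + 5, p <= y < p + 5
                       & nth 0 sigma (x - p) < nth 0 sigma (y - p)])
          (mark_rel b x y).
Proof.
apply: (iffP hasP) => [[p _ /and4P[]]|[p [bp xp yp lt_xy]]]; first by exists p.
by exists p; rewrite ?mem_iota ?(nth_mark_lt _ _ bp) //; apply/and4P.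
Qed.

Lemma mark_rel_irr (b : bitseq) : irreflexive (mark_rel b).
Proof. by move=> x; apply/mark_relP => -[p []]; rewrite ltnn. Qed.

Lemma linkedP (b : bitseq) : size b != 1 ->
  reflect (nth false b 0 /\
           forall p, nth false b p -> p + 5 = size b \/
             p + 5 < size b /\ exists2 q, nth false b q & p < q < p + 5)
          (linked b).
Proof.
move=> nb1; rewrite /linked (negbTE nb1); apply: (iffP andP) => -[b0 lk].
  split=> // p bp; have := allP lk p; rewrite mem_iota (nth_mark_lt _ _ bp) bp /=.
  move=> /(_ isT) /orP[/eqP|/andP[lt_pb /hasP[q _ /andP[bq pq]]]]; first by left.
  by right; split=> //; exists q.
split=> //; apply/allP => p _; apply/implyP => /lk[/eqP-> //|[-> [q bq pq]]].
apply/orP; right; apply/hasP; exists q; last by rewrite bq.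
by rewrite mem_iota (nth_mark_lt _ _ bq).
Qed.

Lemma linked_cover (b : bitseq) y : linked b -> 0 < y < size b ->
  exists2 p, nth false b p & p < y < p + 5.
Proof.
move=> lk /andP[y0 yb]; have nb1 : size b != 1 by lia.
have [b0 next] := linkedP b nb1 lk.
have ex0 : exists p, nth false b p && (p < y) by exists 0; rewrite b0.
have ub p : nth false b p && (p < y) -> p <= y by case/andP => _ /ltnW.
case: (ex_maxnP ex0 ub) => p /andP[bp py] maxp; exists p => //.
rewrite py /= ltnNge; apply/negP => le_y.
case: (next p bp) => [|[_ [q bq /andP[pq qp]]]]; first by lia.
have := maxp q; rewrite bq; lia.
Qed.

Section MarkedPermutations.
Variable n : nat.
Implicit Types (pi : {perm 'I_n}) (A : {set 'I_n}).

Lemma entryE pi (x : 'I_n) : entry pi x = pi x.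
Proof. by rewrite /entry valK. Qed.

Lemma occurrenceP pi p :
  reflect (p + 5 <= n /\
           forall x y : 'I_n, p <= x < p + 5 -> p <= y < p + 5 ->
             nth 0 sigma (x - p) < nth 0 sigma (y - p) -> pi x < pi y)
          (occurrence pi p).
Proof.
apply: (iffP andP) => -[le_pn occ]; split=> //.
  move=> x y xp yp lt_xy.
  have hx : x - p < m by rewrite /m; lia.
  have hy : y - p < m by rewrite /m; lia.
  move/forallP/(_ (Ordinal hx))/forallP/(_ (Ordinal hy)): occ.
  rewrite /= !subnKC; [|lia|lia]; by rewrite !entryE lt_xy => /eqP.
apply/forallP => a; apply/forallP => b.
have in_n (c : 'I_m) : p + c < n by have := ltn_ord c; move: le_pn; rewrite /m; lia.
have in_p (c : 'I_m) : p <= p + c < p + 5 by have := ltn_ord c; rewrite /m; lia.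
have eE (c : 'I_m) : entry pi (p + c) = pi (Ordinal (in_n c)) by rewrite -entryE.
have mono (c d : 'I_m) : nth 0 sigma c < nth 0 sigma d ->
    entry pi (p + c) < entry pi (p + d).
  by move=> lt_cd; rewrite !eE; apply: occ; rewrite //= !addKn.
have [lt_ab|lt_ba|eq_ab] := ltngtP (nth 0 sigma a) (nth 0 sigma b).
- by rewrite mono.
- by rewrite eqbF_neg -leqNgt ltnW // mono.
have /eqP -> : a == b.
  have -> : (a == b) = (nth 0 sigma a == nth 0 sigma b).
    by rewrite -val_eqE (nth_uniq 0 (s := sigma)) //; apply: ltn_ord.
  exact/eqP.
by rewrite ltnn.
Qed.

(** Splits the cluster condition into one on the marks alone and one on the permutation given the
    marks, which [linext] counts. *)
Lemma is_cluster_linked pi A : 5 <= n ->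
  is_cluster pi A = linked (set_mask n A) &&
    [forall x : 'I_n, forall y : 'I_n,
       mark_rel (set_mask n A) x y ==> (pi x < pi y)].
Proof.
move=> n5; set b := set_mask n A; have sb : size b = n := size_set_mask n A.
have bP p : nth false b p -> exists2 i : 'I_n, i \in A & p = i.
  move=> bp; have lt_pn : p < n by rewrite -sb nth_mark_lt.
  by exists (Ordinal lt_pn); rewrite // -nth_set_mask.
have monoP : reflect (forall x y : 'I_n, mark_rel b x y -> pi x < pi y)
    [forall x : 'I_n, forall y : 'I_n, mark_rel b x y ==> (pi x < pi y)].
  apply: (iffP forallP) => [mono x y|mono x]; last first.
    by apply/forallP => y; apply/implyP/mono.
  by have /forallP/(_ y)/implyP := mono x.
have lkP := linkedP b; rewrite sb in lkP.
apply/idP/andP => [/andP[/andP[occ cov] ovl]|[lk mono]].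
  have {}occ p : nth false b p -> occurrence pi p.
    by case/bP => i iA ->; apply: (implyP (forallP occ i)).
  split; last first.
    apply/monoP => x y /mark_relP[p [bp xp yp lt_xy]].
    by have /occurrenceP[_] := occ p bp; apply.
  have {}cov j : j < n -> exists2 p, nth false b p & p <= j < p + 5.
    move=> lt_jn; have /existsP[p /andP[pA pj]] := forallP cov (Ordinal lt_jn).
    by exists p; rewrite ?nth_set_mask.
  apply/lkP; first by lia.
  split; first by case: (cov 0) => [|[|p] bp p0] //; lia.
  move=> p bp; have /occurrenceP[le_pn _] := occ p bp.
  have [|ne_pn] := eqVneq (p + 5) n; first by left.
  have lt_pn : p + 5 < n by lia.
  (* Covering position [p + 5] yields a mark after [p]; the least such mark is successive to [p], so
     the overlap condition puts it before [p + 5]. *)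
  right; split=> //; have [q' bq' pq'] := cov _ lt_pn.
  have ex_q : exists q, nth false b q && (p < q) by exists q'; rewrite bq'; lia.
  case: (ex_minnP ex_q) => q /andP[bq pq] minq; exists q => //; rewrite pq /=.
  have [i iA pi_] := bP p bp; have [j jA qj] := bP q bq.
  move: ovl => /forallP/(_ i)/implyP/(_ iA)/forallP/(_ j)/implyP/(_ jA)/implyP.
  rewrite -pi_ -qj /m; apply; rewrite pq /=; apply/forallP => r.
  apply/implyP => rA; have := minq r; rewrite nth_set_mask rA /=; lia.
have [|b0 next] := lkP _ lk; first by lia.
have occ p : nth false b p -> occurrence pi p.
  move=> bp; apply/occurrenceP; split; first by case: (next p bp) => [|[]]; lia.
  move=> x y xp yp lt_xy; apply: (monoP mono).
  by apply/mark_relP; exists p.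
apply/andP; split; first (apply/andP; split).
- by apply/forallP => p; apply/implyP => pA; apply: occ; rewrite nth_set_mask.
- apply/forallP => j.
  have [p bp pj] : exists2 p, nth false b p & p <= j < p + 5.
    have [j0|j0] := posnP j; first by exists 0; rewrite // j0.
    have [|p bp pj] := linked_cover b j lk; first by rewrite j0 sb ltn_ord.
    by exists p; rewrite // ltnW //; case/andP: pj.
  have [i iA eq_pi] := bP p bp.
  by apply/existsP; exists i; rewrite iA -eq_pi.
apply/forallP => p; apply/implyP => pA; apply/forallP => q; apply/implyP => qA.
apply/implyP => /andP[pq /forallP consec].
have bp : nth false b p by rewrite nth_set_mask.
have bq : nth false b q by rewrite nth_set_mask.
have le_qn : q + 5 <= n by case: (next q bq) => [|[]]; lia.
(* If [q] were at distance 5 or more, the mark [r] would lie strictly between [p] and [q]. *)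
have [|[_ [r br pr]]] := next p bp; first by rewrite /m; lia.
have [i iA ri] := bP r br; have := consec i; rewrite iA -ri /= /m; lia.
Qed.

End MarkedPermutations.

Definition weight (b : bitseq) : int :=
  if linked b then
    ((-1) ^+ count id b * (linext (mark_rel b) (iota 0 (size b)))%:Z)%R
  else 0%R.

Definition weight_sum (n : nat) : int := (\sum_(b <- masks n) weight b)%R.

(** Exchanging the sums groups clusters by their marks, for which the sign is constant. *)
Lemma t_n_weight_sum n : 0 < n -> t_n n = weight_sum n.
Proof.
move=> n0; rewrite /weight_sum; have [n5|n5] := ltnP n 5; last first.
  rewrite -(perm_big _ (set_masks_perm n)) big_map big_enum /=.
  rewrite /t_n.
  have sE k : ((s_nk n k)%:Z = \sum_(x : {perm 'I_n} * {set 'I_n} |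
      is_cluster x.1 x.2 && (#|x.2| == k)) 1)%R.
    rewrite /s_nk ifN; last by rewrite -leqNgt.
    rewrite -natz -sum1_card natr_sum; apply: eq_bigl => x.
    by rewrite inE.
  under [LHS]eq_bigr => k _ do rewrite sE mulr_sumr.
  pose c (x : {perm 'I_n} * {set 'I_n}) : 'I_n.+1 := inord #|x.2|.
  have cE x : c x = #|x.2| :> nat.
    by rewrite inordK // ltnS -[X in _ <= X]card_ord max_card.
  transitivity (\sum_(x : {perm 'I_n} * {set 'I_n} | is_cluster x.1 x.2)
                  (-1) ^+ #|x.2| : int)%R.
    rewrite (partition_big c predT) //=; apply: eq_bigr => k _.
    rewrite (eq_bigl (fun x => is_cluster x.1 x.2 && (#|x.2| == k))).
      by apply: eq_bigr => x /andP[_ /eqP ->]; rewrite mulr1.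
    by move=> x; rewrite -cE.
  rewrite -(pair_big_dep predT (fun pi A => is_cluster pi A)
              (fun _ A => (-1) ^+ #|A| : int)%R) /=.
  rewrite (exchange_big_dep predT) //=; apply: eq_bigr => A _.
  rewrite /weight count_set_mask size_set_mask sumr_const.
  rewrite -mulr_natr natz; case: ifP => lk.
    rewrite -card_perm_linext; last exact: mark_rel_irr.
    congr (_ * _%:Z)%R; apply: eq_card => pi.
    by rewrite inE -[LHS]/(is_cluster pi A) is_cluster_linked // lk.
  rewrite eq_card0 ?mulr0 // => pi.
  by rewrite -[LHS]/(is_cluster pi A) is_cluster_linked // lk.
(* Below length 5 no mark fits, so only the unmarked single entry contributes. *)
rewrite /t_n /s_nk n5; have [->|n1] := eqVneq n 1.
  rewrite !big_ord_recl big_ord0 /= !big_cons big_nil /weight /linext /=.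
  by rewrite big_cons big_nil.
rewrite big1 ?big_seq => [|k _]; last by rewrite mulr0.
rewrite big1 // => b; rewrite mem_masks /weight => /eqP sb.
case: ifP => // lk; have nb1 : size b != 1 by rewrite sb.
have [b0 next] := linkedP b nb1 lk.
by case: (next 0 b0) => [|[]]; lia.
Qed.

(** * Cutting a cluster after its first run *)

(* The entries of 15243 increase along the offsets 0, 2, 4, 3, 1. *)
Lemma mark_rel_offsetP (b : bitseq) x y :
  reflect (exists2 p, nth false b p &
             x = p /\ p < y < p + 5 \/
             x = p + 2 /\ (y = p + 1 \/ y = p + 3 \/ y = p + 4) \/
             x = p + 4 /\ (y = p + 1 \/ y = p + 3) \/
             x = p + 3 /\ y = p + 1)
          (mark_rel b x y).
Proof.
apply: (iffP (mark_relP b x y)) => [[p [bp xp yp lt_xy]]|[p bp xy]]; exists p => //.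
  have [d eq_x] : exists d, x = p + d by exists (x - p); lia.
  have [e eq_y] : exists e, y = p + e by exists (y - p); lia.
  have : d < 5 by lia.
  have : e < 5 by lia.
  move: lt_xy; rewrite eq_x eq_y !addKn.
  by case: d e {eq_x eq_y xp yp} => [|[|[|[|[|d]]]]] [|[|[|[|[|e]]]]] //=; lia.
have [d [eq_x [e eq_y]]] : exists d, x = p + d /\ exists e, y = p + e.
  by exists (x - p); split; [|exists (y - p)]; lia.
split=> //; try lia.
rewrite eq_x eq_y !addKn.
have : d < 5 by lia.
have : e < 5 by lia.
move: xy; rewrite eq_x eq_y {eq_x eq_y}.
by case: d e => [|[|[|[|[|d]]]]] [|[|[|[|[|e]]]]] //=; lia.
Qed.

(* Prepends a run of marks at the positions 0, 2, ..., 2i - 2. *)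
Definition zigzag (i : nat) (b : bitseq) : bitseq :=
  iter i (fun c => [:: true, false & c]) b.

Lemma size_zigzag i b : size (zigzag i b) = 2 * i + size b.
Proof. elim: i => //= i; lia. Qed.

Lemma nth_zigzag i b p :
  nth false (zigzag i b) p =
  if p < 2 * i then ~~ odd p else nth false b (p - 2 * i).
Proof.
elim: i p => [|i IHi] p; first by rewrite subn0.
case: p => [|[|p]]; [by []|by rewrite ifT //; lia|].
by rewrite /= IHi negbK mulnS.
Qed.

Lemma count_zigzag i b : count id (zigzag i b) = i + count id b.
Proof. by elim: i => //= i ->; rewrite add0n addSn. Qed.

(* Here a mark overlaps an earlier one with shift 1 or 3, which is contradictory
   (or, if [i = 0] and [c = false], position 0 is unmarked). *)
Lemma weight_odd_mark i c b : weight (zigzag i [:: c, true & b]) = 0%R.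
Proof.
set B := zigzag _ _; rewrite /weight; case: ifP => // lkB.
have sB : size B = 2 * i + (size b).+2 by rewrite size_zigzag.
have nb1 : size B != 1 by lia.
have [B0 next] := linkedP B nb1 lkB.
have Bq : nth false B (2 * i + 1) by rewrite nth_zigzag ifF ?addKn //; lia.
have le_q : 2 * i + 6 <= size B by case: (next _ Bq) => [|[]]; lia.
have conflict x y : x < size B -> y < size B -> mark_rel B x y ->
    mark_rel B y x -> linext (mark_rel B) (iota 0 (size B)) = 0.
  by move=> xB yB; apply: linext_conflict; rewrite mem_iota.
suff -> : linext (mark_rel B) (iota 0 (size B)) = 0 by rewrite mulr0.
case Ec: c; rewrite Ec in B sB nb1 B0 next Bq le_q conflict lkB *.
  (* Shift 1: the later occurrence has its 1 at [2 * i + 1], but the earlier one has its 5 there and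
     its 2 at [2 * i + 2]. *)
  have Bp : nth false B (2 * i) by rewrite nth_zigzag ltnn subnn.
  apply: (conflict (2 * i + 1) (2 * i + 2)); try lia.
    by apply/mark_rel_offsetP; exists (2 * i + 1) => //; lia.
  by apply/mark_rel_offsetP; exists (2 * i) => //; lia.
case: i => [|i] in B sB nb1 B0 next Bq le_q conflict lkB *; first by [].
(* Shift 3: the later occurrence has its 1 at [2 * i + 3], but the earlier one has its 4 there and
   its 3 at [2 * i + 4]. *)
have Bp : nth false B (2 * i) by rewrite nth_zigzag ifT; lia.
apply: (conflict (2 * i + 3) (2 * i + 4)); try lia.
  by apply/mark_rel_offsetP; exists (2 * i.+1 + 1) => //; lia.
by apply/mark_rel_offsetP; exists (2 * i) => //; lia.
Qed.

Section FirstRun.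
Variables (i : nat) (b : bitseq).
Local Notation B := (zigzag i.+1 [:: false, false & b]).
Local Notation R := (mark_rel B).

Let sizeB : size B = 2 * i + 4 + size b.
Proof. rewrite size_zigzag /=; lia. Qed.

Let nthB p : nth false B p =
  if p <= 2 * i then ~~ odd p else (2 * i + 4 <= p) && nth false b (p - (2 * i + 4)).
Proof.
rewrite nth_zigzag; have [le_p|lt_p] := leqP p (2 * i); first by rewrite ifT //; lia.
case: ifP => [p_lt|_]; first by rewrite [2 * i + 4 <= p]leqNgt; lia.
have [le_p|p_lt] := leqP (2 * i + 4) p.
  by have -> : p - 2 * i.+1 = (p - (2 * i + 4)).+2 by lia.
have : p - 2 * i.+1 < 2 by lia.
by case: (p - _) => [|[]].
Qed.

Let Blo p : p <= 2 * i -> ~~ odd p -> nth false B p.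
Proof. by rewrite nthB => ->. Qed.

Let Bb p : nth false B (2 * i + 4 + p) = nth false b p.
Proof. by rewrite nthB ifF ?addKn ?leq_addr //; lia. Qed.

Let Bcase p : nth false B p -> p <= 2 * i /\ ~~ odd p \/
  exists2 q, p = 2 * i + 4 + q & nth false b q.
Proof.
rewrite nthB; case: ifP => [le_p odd_p|_ /andP[le_p bp]]; first by left.
by right; exists (p - (2 * i + 4)); rewrite ?subnKC.
Qed.

(** The last occurrence of the run ends at [2 * i + 4], the first position of [b]. So [b] must
    either start with a mark or be one unmarked entry that ends the cluster. *)
Lemma linked_zigzag : linked B = linked b.
Proof.
have nB1 : size B != 1 by lia.
have B0 : nth false B 0 by rewrite nthB.
have Bl : nth false B (2 * i) by apply: Blo => //; lia.
have Bnext p : nth false B p -> p < 2 * i -> nth false B (p + 2).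
  move=> + lt_p; rewrite nthB ifT => [even_p|]; last by lia.
  by rewrite nthB ifT; lia.
have [b1|nb1] := eqVneq (size b) 1.
  have -> : linked b = ~~ nth false b 0.
    by rewrite /linked b1; case: (b) b1 => [|x []] //=; rewrite orbF.
  apply/(linkedP B nB1)/idP => [[_ next]|nb0].
    apply/negP => b0; have := next (2 * i + 4).
    by rewrite -[2 * i + 4]addn0 Bb b0 => /(_ isT); case; lia.
  split=> // p Bp; case: (Bcase p Bp) => [[le_p even_p]|[q eq_p bq]].
    have [->|ne_p] := eqVneq p (2 * i); first by left; lia.
    right; split; first by lia.
    by exists (p + 2); [apply: Bnext|]; lia.
  have := nth_mark_lt b q bq; rewrite b1 ltnS leqn0 => /eqP q0.
  by rewrite q0 (negbTE nb0) in bq.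
apply/(linkedP B nB1)/(linkedP b nb1) => -[h0 next]; split.
- case: (next _ Bl) => [|[_ [q Bq pq]]]; first by lia.
  case: (Bcase q Bq) => [[]|[r eq_q br]]; first by lia.
  by have -> : 0 = r by lia.
- move=> p bp; have := next (2 * i + 4 + p); rewrite Bb => /(_ bp).
  case=> [|[lt_p [q Bq pq]]]; [left; lia|right; split; first lia].
  exists (q - (2 * i + 4)); last lia.
  by rewrite -Bb subnKC //; lia.
- by [].
move=> p Bp; case: (Bcase p Bp) => [[le_p even_p]|[q eq_p bq]].
  right; have := nth_mark_lt b 0 h0 => b_gt0; split; first by lia.
  have [->|ne_p] := eqVneq p (2 * i).
    by exists (2 * i + 4 + 0); [rewrite Bb|lia].
  by exists (p + 2); [apply: Bnext|]; lia.
case: (next q bq) => [|[lt_q [r br qr]]]; [left; lia|right; split; first lia].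
by exists (2 * i + 4 + r); [rewrite Bb|lia].
Qed.

Let odds l := [seq y <- iota 0 (2 * l) | odd y].

(** The occurrence at [y - 1] has its 5 at [y] and its 4 at [y + 2], so the entries at odd positions
    decrease and the last one is always the unique minimum. *)
Let odds_chain l : l <= i + 2 -> linext R (odds l) = 1.
Proof.
elim: l => [|l IHl] lt_li; first by rewrite /odds /linext.
have oddsE : odds l.+1 = rcons (odds l) (2 * l + 1).
  rewrite /odds (_ : 2 * l.+1 = 2 * l + 2); last by lia.
  rewrite iotaD filter_cat /= add0n ifN; last by lia.
  by rewrite ifT ?cats1 ?addn1 //; lia.
have mem_odds k y : (y \in odds k) = odd y && (y < 2 * k).
  by rewrite mem_filter mem_iota.
rewrite (linext_unique_min _ _ _ (2 * l + 1)).
- rewrite oddsE filter_rcons eqxx /= (_ : [seq _ <- _ | _] = odds l) ?IHl //.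
    exact: ltnW.
  by apply/all_filterP/allP => y; rewrite mem_odds; lia.
- by rewrite filter_uniq ?iota_uniq.
- by rewrite mem_odds; lia.
- move=> y; rewrite mem_odds => oy; apply/mark_rel_offsetP => -[p Bp].
  by case: (Bcase p Bp) => [|[q]]; lia.
move=> y; rewrite mem_odds => oy ny; apply/hasP; exists (y + 2).
  by rewrite mem_odds; lia.
apply/mark_rel_offsetP; exists (y - 1); [apply: Blo|]; lia.
Qed.

(* The even positions 0, 2, ..., 2i + 4 carry successively the smallest
   remaining entry. *)
Let peeled l := [seq y <- iota 0 (size B) | odd y || (2 * l <= y)].

Let linext_peel l : linked b -> 0 < size b -> l <= i + 3 ->
  linext R (iota 0 (size B)) = linext R (peeled l).
Proof.
move=> lkb b_gt0; elim: l => [|l IHl] lt_li.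
  by rewrite /peeled (@eq_filter _ _ predT) ?filter_predT // => y; rewrite orbT.
have mem_peeled y : (y \in peeled l) = (odd y || (2 * l <= y)) && (y < size B).
  by rewrite mem_filter mem_iota.
have b0 : 1 < size b -> nth false b 0.
  by move=> b_gt1; have [|] := linkedP b _ lkb; lia.
rewrite IHl; last by lia.
rewrite (linext_unique_min _ _ _ (2 * l)).
- by rewrite -filter_predI; congr linext; apply: eq_filter => y /=; lia.
- by rewrite filter_uniq ?iota_uniq.
- by rewrite mem_peeled; lia.
- move=> y; rewrite mem_peeled => hy; apply/mark_rel_offsetP => -[p Bp].
  by case: (Bcase p Bp) => [|[q]]; lia.
(* A smaller remaining entry lies at the start of an occurrence of [b] if [y] is beyond [2 * i + 4];
   otherwise at [y - 2] for even [y], at [y + 2] for odd [y] up to [2 * i + 1], and at [2 * i + 4]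
   for [y] equal to [2 * i + 3]. *)
move=> y; rewrite mem_peeled => hy ny; apply/hasP.
have [lt_y|le_y] := ltnP (2 * i + 4) y.
  have [|p bp py] := linked_cover b (y - (2 * i + 4)) lkb; first by lia.
  exists (2 * i + 4 + p); first by rewrite mem_peeled; lia.
  by apply/mark_rel_offsetP; exists (2 * i + 4 + p); rewrite ?Bb //; lia.
have [odd_y|even_y] := boolP (odd y).
  have [lt_y|ge_y] := ltnP y (2 * i + 3).
    exists (y + 2); first by rewrite mem_peeled; lia.
    apply/mark_rel_offsetP; exists (y - 1); [apply: Blo|]; lia.
  exists (2 * i + 4); first by rewrite mem_peeled; lia.
  by apply/mark_rel_offsetP; exists (2 * i); [apply: Blo|]; lia.
exists (y - 2); first by rewrite mem_peeled; lia.
have [lt_y|ge_y] := ltnP y (2 * i + 4).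
  by apply/mark_rel_offsetP; exists (y - 2); [apply: Blo|]; lia.
by apply/mark_rel_offsetP; exists (2 * i); [apply: Blo|]; lia.
Qed.

(** Position [2 * i + 4] carries the minimum of [b], so omitting it changes no count. Marks of the
    run relate no two later positions, and the rest is a translate of [b]. *)
Lemma linext_tail : linked b -> 0 < size b ->
  linext R (iota (2 * i + 5) (size b).-1) =
  linext (mark_rel b) (iota 0 (size b)).
Proof.
move=> lkb; case sb: (size b) => [//|c] _ /=.
rewrite (linext_unique_min _ _ (0 :: _) 0).
- rewrite /= (_ : [seq _ <- _ | _] = iota 1 c); last first.
    by apply/all_filterP/allP => y; rewrite mem_iota; lia.
  rewrite (_ : 2 * i + 5 = 2 * i + 4 + 1); last by lia.
  rewrite iotaDl linext_map; last exact: addnI.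
  apply: eq_in_linext => x y _ _ /=.
  apply/mark_rel_offsetP/mark_rel_offsetP => -[p Bp xy].
    case: (Bcase p Bp) => [|[q eq_p bq]]; first by lia.
    by exists q => //; lia.
  by exists (2 * i + 4 + p); rewrite ?Bb //; lia.
- by rewrite /= mem_iota iota_uniq andbT.
- by rewrite mem_head.
- by move=> y _; apply/mark_rel_offsetP => -[p _]; lia.
move=> y; rewrite in_cons mem_iota => hy ny; apply/hasP.
have [|p bp py] := linked_cover b y lkb; first by lia.
exists p; first by rewrite in_cons mem_iota; lia.
by apply/mark_rel_offsetP; exists p => //; lia.
Qed.

(** Peeling [i + 3] even positions leaves a chain of [i + 2] odd ones and [(size b).-1] later ones.
    No mark relates the two parts, so they shuffle freely. *)
Lemma linext_zigzag : linked b -> 0 < size b ->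
  linext R (iota 0 (size B)) =
  'C(i.+1 + size b, i.+2) * linext (mark_rel b) (iota 0 (size b)).
Proof.
move=> lkb b_gt0; rewrite (linext_peel (i + 3)) // -linext_tail //.
have peelE : peeled (i + 3) = odds (i + 2) ++ iota (2 * i + 5) (size b).-1.
  rewrite /peeled (_ : size B = 2 * (i + 2) + (1 + (size b).-1)); last by lia.
  rewrite iotaD iotaD filter_cat filter_cat /= add0n ifN; last by lia.
  rewrite cat0s; congr (_ ++ _).
    by apply: eq_in_filter => y; rewrite mem_iota; lia.
  rewrite (_ : 2 * (i + 2) + 1 = 2 * i + 5); last by lia.
  by apply/all_filterP/allP => y; rewrite mem_iota; lia.
have lo_odds : all (fun y => y < 2 * i + 4) (odds (i + 2)).
  by apply/allP => y; rewrite mem_filter mem_iota; lia.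
have hi_tail : all (fun y => ~~ (y < 2 * i + 4)) (iota (2 * i + 5) (size b).-1).
  by apply/allP => y; rewrite mem_iota; lia.
have size_odds l : size (odds l) = l.
  elim: l => // l IHl; rewrite /odds (_ : 2 * l.+1 = 2 * l + 2); last by lia.
  rewrite iotaD filter_cat size_cat IHl /= add0n ifN; last by lia.
  by rewrite ifT /= ?addn1 //; lia.
rewrite (linext_shuffle _ _ _ (fun y => y < 2 * i + 4)); last 2 first.
- by rewrite filter_uniq ?iota_uniq.
- move=> x y; rewrite !mem_filter !mem_iota => hx hy /mark_rel_offsetP[p Bp].
  by case: (Bcase p Bp) => [|[q]]; lia.
rewrite peelE !filter_cat size_cat count_cat size_odds size_iota.
have lo_hi : [seq y <- odds (i + 2) | ~~ (y < 2 * i + 4)] = [::].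
  by apply/eqP; rewrite -(negbK (_ == _)) -has_filter has_predC lo_odds.
have hi_lo : [seq y <- iota (2 * i + 5) (size b).-1 | y < 2 * i + 4] = [::].
  by apply/eqP; rewrite -(negbK (_ == _)) -has_filter -all_predC.
rewrite lo_hi hi_lo cats0 cat0s (all_filterP lo_odds) (all_filterP hi_tail).
rewrite odds_chain // mul1n; congr ('C(_, _) * _); first by lia.
rewrite -(size_filter _ (iota _ _)) hi_lo addn0.
by move: lo_odds; rewrite all_count size_odds => /eqP ->; lia.
Qed.

End FirstRun.

(** * The recurrence and the functional equation *)

Local Open Scope ring_scope.

Lemma weight_zigzag i (b : bitseq) :
  weight (zigzag i.+1 [:: false, false & b]) =
  (-1) ^+ i.+1 * 'C(i.+1 + size b, i.+2)%:Z * weight b.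
Proof.
rewrite /weight linked_zigzag; case: ifP => [lkb|]; last by rewrite mulr0.
have b_gt0 : (0 < size b)%N by case: (b) lkb.
rewrite linext_zigzag // count_zigzag /= !add0n exprD PoszM.
by rewrite -!mulrA; congr (_ * _); rewrite mulrCA.
Qed.

Lemma big_masksS n (F : bitseq -> int) :
  \sum_(b <- masks n.+1) F b =
  \sum_(b <- masks n) F (true :: b) + \sum_(b <- masks n) F (false :: b).
Proof. by rewrite /= big_cat !big_map. Qed.

(** The next two bits either prolong the run or end it; a mark on the second of them contributes
    zero. *)
Lemma zigzag_sumSS i n :
  \sum_(b <- masks n.+2) weight (zigzag i b) =
  \sum_(b <- masks n) weight (zigzag i.+1 b) +
  \sum_(b <- masks n) weight (zigzag i [:: false, false & b]).
Proof.
have z c : \sum_(b <- masks n) weight (zigzag i [:: c, true & b]) = 0.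
  by rewrite big1 // => b _; apply: weight_odd_mark.
rewrite !big_masksS !z !add0r; congr (_ + _); apply: eq_bigr => b _.
by rewrite /zigzag iterSr.
Qed.

(** Here [l] is the number of further marks in the run before two unmarked bits end it. *)
Lemma zigzag_sum i n :
  \sum_(b <- masks n) weight (zigzag i.+1 b) =
  \sum_(l < n./2) (-1) ^+ (i + l).+1 *
    'C((i + l).+1 + (n - l.*2.+2), (i + l).+2)%:Z * weight_sum (n - l.*2.+2)%N.
Proof.
elim/ltn_ind: n i => -[|[|n]] IHn i.
(* With at most one bit left, the occurrence at [2 * i] does not fit. *)
1,2: rewrite big_ord0 big_seq big1 // => b; rewrite mem_masks /weight => /eqP sb.
1,2: have sB : size (zigzag i.+1 b) = (2 * i.+1 + size b)%N by rewrite size_zigzag.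
1,2: case: ifP => // lkB; have nB1 : size (zigzag i.+1 b) != 1%N by lia.
1,2: have [_ next] := linkedP _ nB1 lkB.
1,2: have Bl : nth false (zigzag i.+1 b) (2 * i) by rewrite nth_zigzag ifT; lia.
1,2: by case: (next _ Bl) => [|[]]; lia.
rewrite zigzag_sumSS IHn // [RHS]big_ord_recl addrC; congr (_ + _).
  rewrite addn0 double0 subn2 /= /weight_sum mulr_sumr big_seq [RHS]big_seq.
  apply: eq_bigr => b; rewrite mem_masks => /eqP <-; exact: weight_zigzag.
by apply: eq_bigr => l _; rewrite lift0 addSn addnS doubleS !subSS.
Qed.

(** The recurrence at length [n.+2] with j = l + 2: words starting with two unmarked positions are
    not linked, so a run starts at 0. *)
Lemma weight_sumSS n : weight_sum n.+2 =
  \sum_(l < n./2) (-1) ^+ l.+1 *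
    'C(l.+1 + (n - l.*2.+2), l.+2)%:Z * weight_sum (n - l.*2.+2)%N.
Proof.
by rewrite /weight_sum (zigzag_sumSS 0) zigzag_sum [X in _ + X]big1 ?addr0.
Qed.

(** * Coefficients of the powers of x/(1+x^2) *)

Lemma fmulXn k (f : fps) n :
  fmul (fXn k) f n = if (n < k)%N then 0 else f (n - k)%N.
Proof.
rewrite /fmul /fXn; case: ifP => [lt_nk|/negbT].
  rewrite big1 // => i _; rewrite ifN ?mul0r //.
  by have := ltn_ord i; lia.
rewrite -leqNgt -ltnS => lt_kn; rewrite (bigD1 (Ordinal lt_kn)) //= eqxx mul1r.
rewrite big1 ?addr0 // => i; rewrite -val_eqE /= => /negbTE ->.
by rewrite mul0r.
Qed.

Section Composition.
Variable g : fps.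
Hypothesis gE : forall n, fmul (fadd (fconst 1) (fXn 2)) g n = fXn 1 n.

Let g_rec n : fmul (fadd (fconst 1) (fXn 2)) g n =
  g n + if (n < 2)%N then 0 else g (n - 2)%N.
Proof.
rewrite -fmulXn /fmul /fadd.
under eq_bigr => i _ do rewrite mulrDl.
rewrite big_split /=; congr (_ + _).
rewrite big_ord_recl /fconst /= mul1r subn0 big1 ?addr0 // => i _.
by rewrite mul0r.
Qed.

Let g0 : g 0 = 0. Proof. by have := gE 0; rewrite g_rec addr0. Qed.
Let g1 : g 1 = 1. Proof. by have := gE 1; rewrite g_rec addr0. Qed.
Let gSS n : g n.+2 = - g n.
Proof.
by have /eqP := gE n.+2; rewrite g_rec subn2 /= addr_eq0 => /eqP.
Qed.

(** Coefficientwise form of (1 + x^2) g^(k+1) = x g^k. *)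
Lemma fpowSSn k n : fpow g k.+1 n.+2 = fpow g k n.+1 - fpow g k.+1 n.
Proof.
rewrite /= /fmul big_ord_recl g0 mul0r add0r big_ord_recl /= g1 mul1r.
rewrite subSS subn0 -sumrN; congr (_ + _); apply: eq_bigr => i _.
by rewrite /= /bump /= !add1n gSS mulNr !subSS.
Qed.

Lemma fpowS0 k : fpow g k.+1 0 = 0.
Proof. by rewrite /= /fmul big_ord1 g0 mul0r. Qed.

Lemma fpowS1 k : fpow g k.+1 1 = fpow g k 0.
Proof. by rewrite /= /fmul !big_ord_recl big_ord0 g0 g1 mul0r add0r mul1r addr0. Qed.

Lemma fpow_lt k n : (n < k)%N -> fpow g k n = 0.
Proof.
elim: k n => // k IHk n; elim/ltn_ind: n => -[|[|n]] IHn lt_nk.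
- exact: fpowS0.
- by rewrite fpowS1 IHk.
by rewrite fpowSSn IHk // IHn ?subr0 //; lia.
Qed.

(** The series [g] is odd, so its k-th power contains only exponents of the parity of k. *)
Lemma fpow_odd k j : fpow g k (k + j.*2.+1)%N = 0.
Proof.
elim: k j => [//|k IHk] j.
elim: j => [|j IHj].
  have Pk : fpow g k k.+1 = 0 by have := IHk 0%N; rewrite double0 addnS addn0.
  have -> : (k.+1 + 0.*2.+1 = k.+2)%N by lia.
  by rewrite fpowSSn Pk fpow_lt ?subr0.
have -> : (k.+1 + j.+1.*2.+1 = (k + j.+1.*2).+2)%N by lia.
have := IHk j.+1; rewrite addnS fpowSSn => ->.
by have := IHj; rewrite doubleS !addSn !addnS => ->; rewrite subr0.
Qed.

(* [x^k / (1 + x^2)^k], expanded by the negative binomial series *)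
Lemma fpow_even k j :
  fpow g k.+1 (k.+1 + j.*2)%N = (-1) ^+ j * 'C(k + j, j)%:Z.
Proof.
elim: j k => [|j IHj] k.
  rewrite double0 !addn0 bin0 mulr1; elim: k => [|k IHk]; first by rewrite fpowS1.
  by rewrite fpowSSn IHk fpow_lt ?subr0.
elim: k => [|k IHk].
  have -> : (1 + j.+1.*2 = (1 + j.*2).+2)%N by lia.
  rewrite fpowSSn (IHj 0%N) [fpow g 0 _](_ : _ = 0) // sub0r.
  by rewrite !add0n !binn exprS mulN1r mulNr.
have -> : (k.+2 + j.+1.*2 = (k.+2 + j.*2).+2)%N by lia.
rewrite fpowSSn IHj (_ : (k.+2 + j.*2).+1 = k.+1 + j.+1.*2)%N; last by lia.
rewrite IHk exprS mulN1r !mulNr -opprD -mulrDr -PoszD.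
by congr (- (_ * _%:Z)); rewrite [in RHS]addSn binS addSnnS.
Qed.

Lemma sum_even_ord (F : nat -> int) n :
  (forall j, F j.*2.+1 = 0) -> \sum_(d < n.+1) F d = \sum_(j < n./2.+1) F j.*2.
Proof.
move=> Fodd; elim/ltn_ind: n => -[|[|n]] IHn; rewrite ?big_ord1 //.
  by rewrite big_ord_recr /= !big_ord1 (Fodd 0%N) addr0.
rewrite big_ord_recr big_ord_recr /= IHn // [RHS]big_ord_recr /=.
rewrite -addrA; congr (_ + _).
have [odd_n|even_n] := boolP (odd n).
  have [En En'] : n.+1 = (n./2).+1.*2 /\ n.+2 = (n./2).+1.*2.+1 by lia.
  by rewrite {1}En En' Fodd addr0.
have [En En'] : n.+1 = (n./2).*2.+1 /\ n.+2 = (n./2).+1.*2 by lia.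
by rewrite {1}En En' Fodd add0r.
Qed.

Lemma fcomp_coef (f : fps) n :
  fcomp f g n.+1 = \sum_(j < n.+1./2.+1)
    (-1) ^+ j * 'C(n - j, j)%:Z * f (n.+1 - j.*2)%N.
Proof.
(* Re-index by d = n + 1 - k, with k the power of [g]; parity leaves only even d. *)
rewrite /fcomp (reindex_inj rev_ord_inj) /=.
rewrite (eq_bigr (fun d : 'I_n.+2 => f (n.+1 - d)%N * fpow g (n.+1 - d) n.+1));
  last by move=> d _; rewrite subSS.
rewrite (sum_even_ord (fun d => f (n.+1 - d)%N * fpow g (n.+1 - d) n.+1)).
  apply: eq_bigr => j _; rewrite mulrC; congr (_ * _).
  have le_jn : (j.*2 <= n.+1)%N by have := ltn_ord j; lia.
  have [lt_jn|ge_jn] := ltnP j.*2 n.+1.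
    have Ek : (n.+1 - j.*2 = (n - j.*2).+1)%N by lia.
    rewrite Ek {2}(_ : n.+1 = (n - j.*2).+1 + j.*2)%N ?fpow_even; last by lia.
    by rewrite (_ : n - j.*2 + j = n - j)%N //; lia.
  (* Here k = 0: the constant series has no term of degree n + 1, and the binomial vanishes too,
     since n - j = j - 1. *)
  rewrite (_ : n.+1 - j.*2 = 0)%N; last by lia.
  rewrite bin_small ?mulr0 //; move: le_jn ge_jn; case: j => j /= _; lia.
move=> j; have [lt_jn|ge_jn] := leqP j.*2.+1 n.+1.
  by rewrite -[X in fpow _ _ X](subnK lt_jn) fpow_odd mulr0.
by rewrite (_ : n.+1 - j.*2.+1 = 0)%N ?mulr0 //; lia.
Qed.

End Composition.

(** * The functional equation, coefficient by coefficient *)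

Lemma Tser_weight_sum n : (0 < n)%N -> Tser n = weight_sum n.
Proof. by case: n => // n _; apply: t_n_weight_sum. Qed.

(* g is x/(1+x^2), characterized as the (unique) formal power series with
   (1 + x^2) g(x) = x. *)
Theorem theorem3p8 :
  Tser 0%N = 1%R /\
  forall g : fps,
    (forall n, fmul (fadd (fconst 1) (fXn 2)) g n = fXn 1 n) ->
    forall n, fmul (fXn 3) (fderiv Tser) n
              = fsub (fadd (fconst 1) (fXn 1)) (fcomp Tser g) n.
Proof.
split=> // g gE n; rewrite fmulXn /fsub /fadd /fconst /fXn.
case: n => [|[|n]].
- by rewrite /fcomp big_ord1 mul1r.
- rewrite fcomp_coef // big_ord1 /= /Tser /= /t_n /s_nk.
  by rewrite !big_ord_recl big_ord0.
have -> : (if (n.+2 < 3)%N then 0 else fderiv Tser (n.+2 - 3)%N) = n%:Z * Tser n.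
  by case: n => [|n]; rewrite ?mul0r // /fderiv subSS subSS subSS subn0.
rewrite fcomp_coef // !add0r (_ : n.+2./2.+1 = n./2.+2) //.
(* The terms j = 0 and j = 1 are T_(n+2) and -n T_n; by the recurrence the others sum to
   -T_(n+2). *)
rewrite 2!big_ord_recl !lift0 double0 expr0 expr1 bin0 bin1 !mul1r.
rewrite !subSS !subn0 (_ : \sum_(i < _) _ = - Tser n.+2); first by ring.
rewrite Tser_weight_sum // weight_sumSS -sumrN; apply: eq_bigr => -[l lt_l] _ /=.
rewrite /bump /= !add1n exprS mulN1r !mulNr; congr (- _).
rewrite !doubleS !subSS -doubleS; have lt_ln : (l.*2.+2 <= n)%N by lia.
(* At index 0 [Tser] is 1 while [weight_sum] is 0, but both binomials vanish there. *)
have [eq_n|ne_n] := eqVneq n l.*2.+2.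
  by rewrite !bin_small ?mulr0 ?mul0r //; lia.
rewrite Tser_weight_sum; last by lia.
by rewrite (_ : n - l.+1 = l.+1 + (n - l.*2.+2))%N //; lia.
Qed.
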